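(* Let $G$ and $H$ be graphs with $\mathrm{oh}(G)=s$ and $\mathrm{oh}(H)=t$. Then $\mathrm{oh}(G\square H)\geq \mathrm{oh}(K_s\square K_t)$.
   Context: All graphs are finite, simple and loopless. $\mathrm{oh}(G)$ (Odd Hadwiger number) is the largest integer $m$ for which there exist $m$ pairwise vertex-disjoint trees $Z_1,\dots,Z_m$ in $G$ and a 2-colouring $c$ of $V(Z_1)\cup\dots\cup V(Z_m)$ that is proper on each $Z_k$, such that for every $k\neq k'$ there is an edge $xy\in E(G)$ with $x\in V(Z_k)$, $y\in V(Z_{k'})$, $c(x)=c(y)$. The Cartesian product $G\square H$ has vertex set $V(G)\times V(H)$, with $(v_1,u_1)\sim(v_2,u_2)$ iff ($v_1=v_2$ and $u_1u_2\in E(H)$) or ($u_1=u_2$ and $v_1v_2\in E(G)$). *)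

(* Defs.v *)
From mathcomp Require Import all_boot.
From mathcomp Require Import boolp.

Set Implicit Arguments.
Unset Strict Implicit.
Unset Printing Implicit Defensive.

Record sgraph := SGraph {
  vertex :> finType;
  adj : rel vertex;
  adj_sym : symmetric adj;
  adj_irr : irreflexive adj }.

(* Not necessarily induced. *)
Record subgraph (G : sgraph) := Subgraph {
  sub_vertex : {set G};
  sub_adj : rel G;
  sub_adj_sym : symmetric sub_adj;
  sub_adjP : forall x y, sub_adj x y ->
    [/\ adj x y, x \in sub_vertex & y \in sub_vertex] }.

Section Trees.
Variables (G : sgraph) (Z : subgraph G).

Definition connected : Prop :=
  (exists x, x \in sub_vertex Z) /\
  {in sub_vertex Z &, forall x y, connect (sub_adj Z) x y}.

Definition acyclic : Prop :=
  forall p : seq G, 2 < size p -> ~ ucycle (sub_adj Z) p.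

Definition is_tree : Prop := connected /\ acyclic.

End Trees.

(* The colouring c is total on G, but only its values on the union of the
   vertex sets of the Z k are constrained. *)
Definition odd_clique_model (G : sgraph) (m : nat)
    (Z : 'I_m -> subgraph G) (c : G -> bool) : Prop :=
  [/\ forall k, is_tree (Z k),
      forall k k', k != k' -> [disjoint sub_vertex (Z k) & sub_vertex (Z k')],
      forall k x y, sub_adj (Z k) x y -> c x != c y
    & forall k k', k != k' -> exists x y,
        [/\ x \in sub_vertex (Z k), y \in sub_vertex (Z k'), adj x y
          & c x = c y]].

Definition has_odd_clique (G : sgraph) (m : nat) : Prop :=
  exists (Z : 'I_m -> subgraph G) (c : G -> bool), odd_clique_model Z c.

Lemma has_odd_clique0 (G : sgraph) : has_odd_clique G 0.
Proof.
exists (fun k : 'I_0 => match notF (ltn_ord k) with end), (fun=> false).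
by split; case.
Qed.

Lemma has_odd_clique_card (G : sgraph) (m : nat) :
  has_odd_clique G m -> m <= #|G|.
Proof.
case=> Z [c [Ztree Zdisj _ _]].
have /fin_all_exists [f fP] : forall k, exists x, x \in sub_vertex (Z k).
  by move=> k; case: (Ztree k) => [[]].
rewrite -[m]card_ord; apply: (@leq_card _ _ f) => k k' eq_f.
apply/eqP; apply/negPn/negP => /Zdisj /disjointFr /(_ (fP k)).
by rewrite eq_f fP.
Qed.

Lemma oh_exists (G : sgraph) : exists m, `[< has_odd_clique G m >].
Proof. by exists 0; apply/asboolP/has_odd_clique0. Qed.

Lemma oh_bounded (G : sgraph) (m : nat) :
  `[< has_odd_clique G m >] -> m <= #|G|.
Proof. by move/asboolP/has_odd_clique_card. Qed.

Definition oh (G : sgraph) : nat := ex_maxn (oh_exists G) (@oh_bounded G).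

Lemma ohP (G : sgraph) :
  has_odd_clique G (oh G) /\ forall m, has_odd_clique G m -> m <= oh G.
Proof.
rewrite /oh; case: ex_maxnP => m /asboolP Gm max_m.
by split=> // n Gn; apply/max_m/asboolP.
Qed.

Section Cartesian.
Variables G H : sgraph.

Definition cartesian_adj : rel (G * H) := fun p q =>
  (p.1 == q.1) && adj p.2 q.2 || (p.2 == q.2) && adj p.1 q.1.

Lemma cartesian_adj_sym : symmetric cartesian_adj.
Proof.
move=> p q; rewrite /cartesian_adj.
by rewrite ![_ == q.1]eq_sym ![_ == q.2]eq_sym ![adj _ q.1]adj_sym
           ![adj _ q.2]adj_sym.
Qed.

Lemma cartesian_adj_irr : irreflexive cartesian_adj.
Proof. by move=> p; rewrite /cartesian_adj !adj_irr !andbF. Qed.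

Definition cartesian : sgraph := SGraph cartesian_adj_sym cartesian_adj_irr.

End Cartesian.

Section Complete.
Variable n : nat.

Definition complete_adj : rel 'I_n := fun i j => i != j.

Lemma complete_adj_sym : symmetric complete_adj.
Proof. by move=> i j; rewrite /complete_adj eq_sym. Qed.

Lemma complete_adj_irr : irreflexive complete_adj.
Proof. by move=> i; rewrite /complete_adj eqxx. Qed.

Definition complete : sgraph := SGraph complete_adj_sym complete_adj_irr.

End Complete.

(* Main.v *)
(** Blow up each vertex [(i, j)] of [K_s □ K_t] to the block [Z_i × W_j], where
    [Z_i] and [W_j] are the trees of optimal odd clique models of [G] and [H],
    coloured by [cG] and [cH].  Colour [(x, y)] in that block by
    [c (i, j) + cG x + cH y] modulo 2.  Tree edges inside a block are then
    bichromatic, while a monochromatic edge between [Z_i] and [Z_i'] yields an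
    edge between the blocks of [(i, j)] and [(i', j)] whose ends compare exactly
    as [c (i, j)] and [c (i', j)] do.  Hence every odd clique model of
    [K_s □ K_t] lifts to properly coloured connected subgraphs of [G □ H], and
    spanning trees of these form an odd clique model. *)
Require Import Defs.
From mathcomp Require Import all_boot.
From mathcomp Require Import boolp.

Set Implicit Arguments.
Unset Strict Implicit.
Unset Printing Implicit Defensive.

Lemma homo_connect (T T' : finType) (e : rel T) (e' : rel T') (f : T -> T') :
  {homo f : x y / e x y >-> e' x y} ->
  {homo f : x y / connect e x y >-> connect e' x y}.
Proof.
move=> ef x _ /connectP[p e_p ->].
by apply/connectP; exists (map f p); [exact: homo_path e_p | rewrite last_map].
Qed.

Section SpanningTree.
Variable G : sgraph.
Implicit Type Z : subgraph G.

Definition delete_rel Z (x y : G) : rel G :=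
  fun u v => sub_adj Z u v && ((u, v) \notin [:: (x, y); (y, x)]).

Lemma delete_rel_sym Z x y : symmetric (delete_rel Z x y).
Proof.
move=> u v; rewrite /delete_rel sub_adj_sym !inE !xpair_eqE.
by rewrite orbC [(v == x) && _]andbC [(v == y) && _]andbC.
Qed.

Lemma delete_relP Z x y u v : delete_rel Z x y u v ->
  [/\ adj u v, u \in sub_vertex Z & v \in sub_vertex Z].
Proof. by case/andP=> /sub_adjP. Qed.

Definition delete_edge Z x y : subgraph G :=
  Subgraph (@delete_rel_sym Z x y) (@delete_relP Z x y).

(** The rest of the cycle is a detour from [y] back to [x] that replaces the deleted edge. The
    condition [0 < size q] excludes the degenerate cycle [[:: x; y]], whose return step is that same
    edge. *)
Lemma delete_cycle_edge_connect Z x y q :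
    0 < size q -> ucycle (sub_adj Z) [:: x, y & q] ->
  subrel (connect (sub_adj Z)) (connect (sub_adj (delete_edge Z x y))).
Proof.
case: q => // z q _ /andP[].
rewrite /= !inE !negb_or => /and3P[_ yz zq].
case/and3P=> /and3P[xy xz xq] /andP[yz' yq] _.
set e' := delete_rel Z x y.
have e'_yx : connect e' y x.
  (* Only the step from [y] to [z] touches [y]; the path from [z] on to [x] avoids [y], so all its
     edges survive the deletion. *)
  apply: (@connect_trans _ _ z).
    apply: connect1.
    by rewrite /e' /delete_rel yz !inE !xpair_eqE ![_ == x]eq_sym
               (negPf xy) (negPf xz) ?andbF.
  apply/connectP; exists (rcons q x); last by rewrite last_rcons.
  apply: (sub_in_path (P := predC1 y) _ _ zq) => [u v /= uy vy uv|].
    by rewrite /e' /delete_rel uv !inE !xpair_eqE (negPf uy) (negPf vy) andbF.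
  rewrite /= all_rcons /= xy [z == y]eq_sym yz' /=.
  by apply/allP => w wq /=; apply: contraNneq yq => <-.
apply: connect_sub => u v uv.
have [|uv_del] := boolP ((u, v) \in [:: (x, y); (y, x)]); last first.
  by apply: connect1; apply/andP.
rewrite !inE => /orP[] /eqP[-> ->] //=.
by rewrite (sym_connect_sym (@delete_rel_sym Z x y)).
Qed.

(** Induction on the number of ordered adjacent pairs: while a cycle remains, deleting one of its
    edges keeps the subgraph connected. *)
Lemma spanning_tree Z : connected Z -> exists Z',
  [/\ sub_vertex Z' = sub_vertex Z, subrel (sub_adj Z') (sub_adj Z)
    & is_tree Z'].
Proof.
have [n] := ubnP #|[set p | sub_adj Z p.1 p.2]|.
elim: n Z => // n IHn Z ltn Zconn.
have [Zacyc|] := EM (acyclic Z); first by exists Z; split.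
move=> /existsNP[[|x [|y q]]] /not_implyP[//= q_gt0 /contrapT Zcyc].
have xy : sub_adj Z x y by case/andP: (Zcyc) => /andP[].
case: (IHn (delete_edge Z x y)) => [||Z' [VZ' EZ' treeZ']].
- rewrite ltnS in ltn; apply: leq_trans ltn; apply: proper_card.
  apply/properP; split; first by apply/subsetP=> -[u v]; rewrite !inE => /andP[].
  by exists (x, y); rewrite inE //= /delete_rel !inE eqxx andbF.
- case: Zconn => Z0 Zconn; split=> // u v uZ vZ.
  exact: (delete_cycle_edge_connect _ Zcyc) (Zconn u v uZ vZ).
by exists Z'; split=> // u v /EZ' /andP[].
Qed.

End SpanningTree.

Section Bichromatic.
Variables (G : sgraph) (V : {set G}) (c : G -> bool).

Definition bichromatic : rel G :=
  fun x y => [&& adj x y, x \in V, y \in V & c x != c y].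

Lemma bichromatic_sym : symmetric bichromatic.
Proof.
by move=> x y; rewrite /bichromatic adj_sym eq_sym; congr andb; rewrite andbCA.
Qed.

Lemma bichromaticP x y :
  bichromatic x y -> [/\ adj x y, x \in V & y \in V].
Proof. by case/and4P. Qed.

Definition bichromatic_subgraph : subgraph G :=
  Subgraph bichromatic_sym bichromaticP.

End Bichromatic.

(** A spanning tree of a bichromatic subgraph keeps its vertex set and inherits its proper
    colouring, so connectedness can stand in for being a tree. *)
Lemma has_odd_clique_connected (G : sgraph) m (V : 'I_m -> {set G}) c :
    (forall k, connected (bichromatic_subgraph (V k) c)) ->
    (forall k k', k != k' -> [disjoint V k & V k']) ->
    (forall k k', k != k' -> exists x y,
       [/\ x \in V k, y \in V k', adj x y & c x = c y]) ->
  has_odd_clique G m.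
Proof.
move=> Vconn Vdisj Vadj.
have /choice[Z ZP] := fun k => spanning_tree (Vconn k).
have VZ k : sub_vertex (Z k) = V k by case: (ZP k).
exists Z, c; split=> [k|k k'|k x y|k k'].
- by case: (ZP k).
- by rewrite !VZ; apply: Vdisj.
- by case: (ZP k) => _ EZ _ /EZ /and4P[].
by rewrite !VZ; apply: Vadj.
Qed.

Section BlowUp.
Variables (K G : sgraph) (B : K -> {set G}) (c : G -> bool).
Hypothesis Bconn : forall a, connected (bichromatic_subgraph (B a) c).
Hypothesis Bdisj : forall a b x, x \in B a -> x \in B b -> a = b.
Hypothesis Badj : forall a b, adj a b ->
  exists x y, [/\ x \in B a, y \in B b, adj x y & c x = c y].

Lemma has_odd_clique_blow_up m : has_odd_clique K m -> has_odd_clique G m.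
Proof.
case=> T [d [Ttree Tdisj Tcol Tadj]].
pose U k := \bigcup_(a in sub_vertex (T k)) B a.
(* The existential reads off [d a] for the unique block [B a] containing [x], and is false outside
   all blocks. *)
pose c' x := c x (+) [exists a, (x \in B a) && d a].
have c'E a x : x \in B a -> c' x = c x (+) d a.
  move=> xa; congr (_ (+) _); apply/existsP/idP => [[b /andP[xb]]|da].
    by rewrite (Bdisj xa xb).
  by exists a; rewrite xa.
have inU k a x : a \in sub_vertex (T k) -> x \in B a -> x \in U k.
  by move=> aT xa; apply/bigcupP; exists a.
apply: (@has_odd_clique_connected _ _ U c') => [k|k k' kk'|k k' kk'].
- have [[[a aT] Tconn] _] := Ttree k.
  split; first by have [[x xa] _] := Bconn a; exists x; apply: inU xa.
  (* Within one block [c'] differs from [c] by a constant, so the same edges are bichromatic. *)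
  have Bsub b x y : b \in sub_vertex (T k) -> x \in B b -> y \in B b ->
      connect (bichromatic (U k) c') x y.
    move=> bT xb yb; have [_ /(_ x y xb yb)] := Bconn b.
    apply: connect_sub => u v /and4P[uv ub vb cuv]; apply: connect1.
    rewrite /bichromatic uv !(inU k b) // (c'E b) // (c'E b v) //.
    by rewrite (inj_eq (@addIb _)).
  move=> x y /bigcupP[b bT xb] /bigcupP[b' b'T yb'].
  have /connectP[p] := Tconn b b' bT b'T.
  (* Follow the tree path block by block. The crossing edge is monochromatic for [c], and [d]
     differs at its two blocks, so it is bichromatic for [c']. *)
  elim: p b bT x xb => [|b1 p IHp] b bT x xb /= => [_ eb|/andP[bb1 Tp] eb].
    by apply: (Bsub b) => //; rewrite -eb.
  have [abb1 _ b1T] := sub_adjP bb1.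
  have [u [v [ub vb1 uv cuv]]] := Badj abb1.
  apply: connect_trans (Bsub b x u bT xb ub) _.
  apply: connect_trans (IHp b1 b1T v vb1 Tp eb); apply: connect1.
  rewrite /= /bichromatic uv (inU k b) // (inU k b1) // (c'E b) // (c'E b1) //.
  by rewrite cuv (inj_eq (@addbI _)) (Tcol k).
- apply/pred0P => x /=; apply/negP => /andP[/bigcupP[a aT xa] /bigcupP[b bT xb]].
  by have := disjointFr (Tdisj _ _ kk') aT; rewrite (Bdisj xa xb) bT.
have [a [b [aT bT ab dab]]] := Tadj _ _ kk'.
have [x [y [xa yb xy cxy]]] := Badj ab.
exists x, y; split=> //; [exact: inU xa | exact: inU yb |].
by rewrite (c'E a) // (c'E b) // cxy dab.
Qed.

End BlowUp.

Lemma odd_clique_model_inj (G : sgraph) m (Z : 'I_m -> subgraph G) c i j x :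
    odd_clique_model Z c ->
  x \in sub_vertex (Z i) -> x \in sub_vertex (Z j) -> i = j.
Proof.
case=> _ Zdisj _ _ xi xj; apply/eqP; apply: contraT => /Zdisj/disjointFr.
by move/(_ _ xi); rewrite xj.
Qed.

Lemma has_odd_clique_cartesian (G H : sgraph) s t m :
    has_odd_clique G s -> has_odd_clique H t ->
    has_odd_clique (cartesian (complete s) (complete t)) m ->
  has_odd_clique (cartesian G H) m.
Proof.
move=> [Z [cG ZP]] [W [cH WP]].
have [Ztree _ Zcol Zadj] := ZP; have [Wtree _ Wcol Wadj] := WP.
pose B (a : cartesian (complete s) (complete t)) : {set cartesian G H} :=
  setX (sub_vertex (Z a.1)) (sub_vertex (W a.2)).
pose c (x : cartesian G H) := cG x.1 (+) cH x.2.
apply: (@has_odd_clique_blow_up _ _ B c) => [[i j]|[i j] [i' j'] [x y]|].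
- have [[[x0 x0Z] Zconn] _] := Ztree i; have [[[y0 y0W] Wconn] _] := Wtree j.
  split; first by exists (x0, y0); rewrite /= in_setX x0Z.
  move=> [x y] [x' y'] /setXP[/= xZ yW] /setXP[/= x'Z y'W].
  (* Move along [Z i], then along [W j]; the fixed coordinate adds a constant to the colour. *)
  apply: (@connect_trans _ _ (x', y)).
    apply: (homo_connect (f := fun z => (z, y))) (Zconn x x' xZ x'Z) => u v uv.
    have [auv uZ vZ] := sub_adjP uv.
    rewrite /bichromatic /= /cartesian_adj /= eqxx auv orbT !in_setX /=.
    by rewrite uZ vZ yW /c /= (inj_eq (@addIb _)) (Zcol i).
  apply: (homo_connect (f := fun z => (x', z))) (Wconn y y' yW y'W) => u v uv.
  have [auv uW vW] := sub_adjP uv.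
  rewrite /bichromatic /= /cartesian_adj /= eqxx auv !in_setX /=.
  by rewrite uW vW x'Z /c /= (inj_eq (@addbI _)) (Wcol j).
- move=> /setXP[/= xi yj] /setXP[/= xi' yj'].
  by rewrite (odd_clique_model_inj ZP xi xi') (odd_clique_model_inj WP yj yj').
move=> [i j] [i' j'] /orP[] /andP[/= /eqP<-].
  (* Any vertex [x] of [Z i] serves: [cG x] enters both colours and cancels. *)
  move=> /Wadj[y [y' [yj y'j' yy' cyy']]]; have [[[x xi] _] _] := Ztree i.
  exists (x, y), (x, y'); rewrite /B /c /= !in_setX /= xi yj y'j' cyy'.
  by split=> //; rewrite /cartesian_adj eqxx yy'.
move=> /Zadj[x [x' [xi x'i' xx' cxx']]]; have [[[y yj] _] _] := Wtree j.
exists (x, y), (x', y); rewrite /B /c /= !in_setX /= yj xi x'i' cxx'.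
by split=> //; rewrite /cartesian_adj eqxx xx' orbT.
Qed.

Theorem theorem7 (G H : sgraph) (s t : nat) (hs : oh G = s) (ht : oh H = t) :
  oh (cartesian (complete s) (complete t)) <= oh (cartesian G H).
Proof.
apply: (ohP (cartesian G H)).2; apply: has_odd_clique_cartesian (ohP _).1.
  by rewrite -hs; apply: (ohP G).1.
by rewrite -ht; apply: (ohP H).1.
Qed.
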